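(* Let $R$ be a commutative von Neumann regular ring such that $2$ is a nonzero zero-divisor of $R$ (i.e., $0 \neq 2 \in Z(R)$). Then the following statements are equivalent. (a) Every proper ideal of $R$ is an sdf-absorbing ideal of $R$. (b) Every nonzero proper ideal of $R$ is an sdf-absorbing ideal of $R$. (c) Exactly one maximal ideal $M$ of $R$ has $\operatorname{char}(R/M) \neq 2$.
   Context: All rings are commutative with identity $1 \neq 0$. A proper ideal $I$ of a commutative ring $R$ is a square-difference factor absorbing ideal (sdf-absorbing ideal) of $R$ if whenever $a, b \in R$ are both nonzero and $a^2 - b^2 \in I$, then $a + b \in I$ or $a - b \in I$. A commutative ring $R$ is von Neumann regular if for every $x \in R$ there is a $y \in R$ with $x^2 y = x$. $Z(R)$ denotes the set of zero-divisors of $R$. *)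

(* Defs.v *)
From mathcomp Require Import all_boot all_order all_algebra.

Set Implicit Arguments.
Unset Strict Implicit.
Unset Printing Implicit Defensive.

Import GRing.Theory.
Local Open Scope ring_scope.

(* [idealr R] is the library's type of proper ideals of [R].  Its elements are
   boolean predicates; under the axioms of [mathcomp.classical.boolp] these are
   the same thing as [Prop]-valued ones, so no ideal is excluded.  Ideals are
   compared extensionally, with [=i]. *)

Definition sdf_absorbing (R : comNzRingType) (I : idealr R) : Prop :=
  forall a b : R, a != 0 -> b != 0 ->
    a ^+ 2 - b ^+ 2 \in I -> a + b \in I \/ a - b \in I.

Definition nonzero_ideal (R : comNzRingType) (I : idealr R) : Prop :=
  exists2 x : R, x \in I & x != 0.

Definition maximal_ideal (R : comNzRingType) (M : idealr R) : Prop :=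
  forall J : idealr R, {subset M <= J} -> J =i M.

Definition von_neumann_regular (R : comNzRingType) : Prop :=
  forall x : R, exists y : R, x ^+ 2 * y = x.

Definition zero_divisor (R : comNzRingType) (x : R) : Prop :=
  exists2 y : R, y != 0 & x * y = 0.

(* [[pchar A]] is the set of primes that vanish in [A], so for a field [A] the
   membership of 2 says precisely that [A] has characteristic 2. *)
Definition residue_char_neq2 (R : comNzRingType) (M : idealr R) : Prop :=
  2%N \notin [pchar {ideal_quot M}].

(* Main.v *)
Require Import Defs.
From HB Require Import structures.
From mathcomp Require Import all_boot all_order all_algebra.
From mathcomp Require Import boolp classical_sets ring.

Set Implicit Arguments.
Unset Strict Implicit.

Import GRing.Theory.
Local Open Scope ring_scope.

(** Let [y] satisfy [2 ^+ 2 * y = 2] and put [e = 2 * y].  Then [e] is an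
    idempotent generating the ideal [2R], so [R] splits as the product of [eR],
    where 2 is invertible, and [(1 - e)R], where 2 vanishes.  Both factors are
    nontrivial because 2 is a nonzero zero-divisor.  The maximal ideals of
    residue characteristic other than 2 are those missing [e]; they correspond
    to the maximal ideals of the factor [eR].  The bridge between the
    conditions is that each of them says that [eR] is a field, that is, that
    [e] is a primitive idempotent.

    If some idempotent [f] of [eR] is neither [0] nor [e], then [a = 2 * f - e]
    and [b = e] satisfy [a ^+ 2 = b ^+ 2], while [a + b = 2 * f] and
    [a - b = 2 * (f - e)] stay nonzero in [eR].  Hence the nonzero proper ideal
    [(1 - e)R] is not sdf-absorbing ([sdf_primitive]).

    If [eR] is a field, then [(1 - e)R] is a maximal ideal, and any ideal that
    is not inside it contains [e], hence 2 ([primitive_unique_maximal]).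
    Conversely, two orthogonal nonzero idempotents of [eR] yield two distinct
    maximal ideals avoiding 2, by Zorn's lemma ([unique_maximal_primitive]).

    Finally, if [eR] is a field, let [I] be an ideal containing
    [a ^+ 2 - b ^+ 2].  On the factor [(1 - e)R] the sum and the difference of
    [a] and [b] coincide, and their square lies in the radical ideal [I]; on the
    field [eR], either [a + b] vanishes or it can be divided out of
    [a ^+ 2 - b ^+ 2], which leaves [a - b] in [I] ([primitive_sdf]). *)

(** * Ideals, annihilators and the existence of maximal ideals *)

Lemma idealr_ofP (R : nzRingType) (S : {pred R}) (hS : idealr_closed S) :
  exists I : idealr R, I =i S.
Proof.
pose m := isIdealr.Build R S hS.
pose I : idealr R := HB.pack S m.
by exists I.
Qed.

Lemma ann_ideal (R : comNzRingType) (c : R) (hc : c != 0) :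
  exists I : idealr R, forall x, (x \in I) = (c * x == 0).
Proof.
have [|I hI] := @idealr_ofP R [pred x | c * x == 0].
  split; rewrite ?inE ?mulr0 ?mulr1 // => a u v.
  by rewrite !inE => /eqP hu /eqP hv; rewrite mulrDr hv mulrCA hu mulr0 addr0.
by exists I => x; rewrite hI.
Qed.

Lemma idealr_is_closed (R : nzRingType) (I : idealr R) : idealr_closed I.
Proof.
split; rewrite ?idealr0 ?idealr1 // => a u v uI vI.
by rewrite rpredD ?idealMr.
Qed.

(** Zorn's lemma, applied to the proper ideals containing [I]: the union of a
    nonempty chain of them is again one. *)
Lemma exists_maximal_ideal (R : comNzRingType) (I : idealr R) :
  exists2 M : idealr R, maximal_ideal M & {subset I <= M}.
Proof.
(* Ideals are ordered as bare predicates: the type of bundled ideals lives in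
   too large a universe for Zorn's lemma. *)
pose T := {S : R -> bool | idealr_closed S /\ {subset I <= S}}.
pose le (J K : T) := `[< {subset sval J <= sval K} >].
pose I0 : T :=
  exist _ (I : R -> bool) (conj (idealr_is_closed I) (fun _ h => h)).
have [||A totA|[M [cM IM]] maxM] := @ZL_preorder T I0 le.
- by move=> J; apply/asboolP.
- move=> K J L /asboolP KJ /asboolP JL; apply/asboolP => x /KJ; exact: JL.
- have [[J0 AJ0]|A0] := pselect (exists J, A J); last first.
    by exists I0 => J AJ; case: A0; exists J.
  pose U : R -> bool := fun x => `[< exists2 J, A J & x \in sval J >].
  have inU x : reflect (exists2 J, A J & x \in sval J) (x \in U).
    exact: asboolP.
  have cU : idealr_closed U.
    split.
    + by apply/inU; exists J0 => //; case: (svalP J0) => -[].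
    + by apply/negP => /inU[J _]; apply/negP; case: (svalP J) => -[].
    + move=> a u v /inU[J AJ uJ] /inU[K AK vK]; apply/inU.
      have [/asboolP JK|/asboolP KJ] := totA _ _ AJ AK.
        exists K => //; case: (svalP K) => -[_ _ cK] _.
        by apply: cK => //; apply: JK.
      exists J => //; case: (svalP J) => -[_ _ cJ] _.
      by apply: cJ => //; apply: KJ.
  have IU : {subset I <= U}.
    by move=> x xI; apply/inU; exists J0 => //; case: (svalP J0) => _; apply.
  exists (exist _ U (conj cU IU)) => J AJ; apply/asboolP => x xJ /=.
  by apply/inU; exists J.
have [M' hM'] := idealr_ofP cM.
exists M' => [J MJ|x /IM]; last by rewrite hM'.
have {}MJ : {subset M <= J} by move=> x xM; apply: MJ; rewrite hM'.
have IJ : {subset I <= J} by move=> x /IM; exact: MJ.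
have /asboolP JM :=
  maxM (exist _ (J : R -> bool) (conj (idealr_is_closed J) IJ)) (asboolT MJ).
by move=> x; rewrite hM'; apply/idP/idP; [exact: JM | exact: MJ].
Qed.

(** The element [1 - f] of [M] excludes [f] from it, so a nonzero idempotent is
    avoided by some maximal ideal. *)
Lemma maximal_ideal_of_idempotent (R : comNzRingType) (f : R)
    (hf : f * f = f) (f0 : f != 0) :
  exists2 M : idealr R, maximal_ideal M & 1 - f \in M.
Proof.
have [I hI] := ann_ideal f0.
have [M maxM IM] := exists_maximal_ideal I.
by exists M => //; apply: IM; rewrite hI mulrBr mulr1 hf subrr.
Qed.

Lemma residue_char_neq2P (R : comNzRingType) (M : idealr R) :
  residue_char_neq2 M <-> 2%:R \notin M.
Proof.
suff h : (2%:R == 0 :> {ideal_quot M}) = (2%:R \in M).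
  by rewrite /residue_char_neq2 inE /= h.
pose p := \pi_({ideal_quot M})%qT : {rmorphism R -> {ideal_quot M}}.
by rewrite -[in RHS](subr0 2%:R) Quotient.idealrBE -(rmorph_nat p) -(rmorph0 p).
Qed.

(** * Von Neumann regular rings and primitive idempotents *)

Lemma vnr_radical (R : comNzRingType) (hR : von_neumann_regular R)
    (I : idealr R) (x : R) : x ^+ 2 \in I -> x \in I.
Proof. by move=> xI; have [y <-] := hR x; rewrite mulrC idealMr. Qed.

Definition primitive_idempotent (R : comNzRingType) (e : R) : Prop :=
  [/\ e != 0, e * e = e &
      forall f : R, f * f = f -> e * f = f -> f = 0 \/ f = e].

(** The factor [eR] cut out by a primitive idempotent is a field: the idempotent
    attached to a nonzero element [e * x] of [eR] can only be [e] itself. *)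
Lemma primitive_dvd (R : comNzRingType) (hR : von_neumann_regular R) (e x : R)
    (he : primitive_idempotent e) (ex0 : e * x != 0) :
  exists z, e = z * x.
Proof.
have [e0 ee prim] := he; have [y hy] := hR (e * x).
have [| |f0|<-] := prim (e * x * y).
- by rewrite -[in RHS]hy; ring.
- by rewrite -[in RHS]ee; ring.
- by case/eqP: ex0; rewrite -hy expr2 -mulrA f0 mulr0.
- by exists (e * y); ring.
Qed.

Lemma primitive_mem (R : comNzRingType) (hR : von_neumann_regular R) (e x : R)
    (he : primitive_idempotent e) (I : idealr R) :
  x \in I -> e * x != 0 -> e \in I.
Proof. by move=> xI /primitive_dvd[]// z ->; exact: idealMr. Qed.

(** * The three conditions and the factor where 2 is invertible *)

(** [2 * y] is the idempotent that generates the ideal [2R]. *)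
Lemma two_idempotent (R : comNzRingType) (y : R) (hy : 2%:R ^+ 2 * y = 2%:R) :
  (2%:R * y) * (2%:R * y) = 2%:R * y /\ (2%:R * y) * 2%:R = 2%:R.
Proof. by split; rewrite -[in RHS]hy; ring. Qed.

(** The maximal ideal is [(1 - e)R], written as the annihilator of
    [e = 2 * y]; it contains every maximal ideal that avoids 2, because an ideal
    with an element outside it contains [e], a divisor of 2. *)
Lemma primitive_unique_maximal (R : comNzRingType)
    (hR : von_neumann_regular R) (y : R) (hy : 2%:R ^+ 2 * y = 2%:R)
    (he : primitive_idempotent (2%:R * y)) :
  exists M : idealr R,
    [/\ maximal_ideal M, residue_char_neq2 M &
        forall N : idealr R,
          maximal_ideal N -> residue_char_neq2 N -> N =i M].
Proof.
have [ee e2] := two_idempotent hy; have [e0 _ _] := he.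
set e := 2%:R * y in he e0 ee e2 *.
have [M hM] := ann_ideal e0; exists M; split.
- move=> J MJ x; apply/idP/idP => [xJ|]; last exact: MJ.
  rewrite hM; apply: contraT => ex0.
  have eJ := primitive_mem hR he xJ ex0.
  have : e + (1 - e) \in J.
    by rewrite rpredD // MJ // hM mulrBr mulr1 ee subrr.
  by rewrite addrC subrK idealr1.
- apply/residue_char_neq2P; rewrite hM e2.
  by apply: contraNneq e0 => h; rewrite /e h mul0r.
- move=> N maxN /residue_char_neq2P N2 x; apply/esym; move: x.
  apply: maxN => x xN.
  rewrite hM; apply: contraNT N2 => ex0.
  by rewrite -e2 mulrC idealMr // (primitive_mem hR he xN).
Qed.

(** Let [e = 2 * y].  If [f] is an idempotent of [eR] other than [0] and [e],
    then maximal ideals containing [1 - f] and [1 - (e - f)] both avoid 2, and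
    they are distinct because [f] and [e - f] are orthogonal. *)
Lemma unique_maximal_primitive (R : comNzRingType) (y : R)
    (h2 : 2%:R != 0 :> R) (hy : 2%:R ^+ 2 * y = 2%:R) (M : idealr R)
    (uniqM : forall N : idealr R,
       maximal_ideal N -> residue_char_neq2 N -> N =i M) :
  primitive_idempotent (2%:R * y).
Proof.
have [ee e2] := two_idempotent hy.
set e := 2%:R * y in ee e2 *.
have key g : g * g = g -> e * g = g -> g != 0 -> 1 - g \in M.
  move=> gg eg g0; have [N maxN gN] := maximal_ideal_of_idempotent gg g0.
  rewrite -(uniqM N) //; apply/residue_char_neq2P; apply/negP => N2.
  have: (g * y) * 2%:R + (1 - g) \in N by rewrite rpredD ?idealMr.
  by rewrite -mulrA [y * _]mulrC -/e [g * e]mulrC eg addrC subrK idealr1.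
split=> // [|f ff ef].
  by apply: contraNneq h2 => e0; rewrite -e2 e0 mul0r.
have [->|f0] := eqVneq f 0; first by left.
have [->|fe] := eqVneq f e; [by right|exfalso].
have M1 := key f ff ef f0.
have fM : f * (1 - (e - f)) \in M.
  apply/idealMr/key; last by rewrite subr_eq0 eq_sym.
    by rewrite mulrBl !mulrBr ee ff [f * e]mulrC ef subrr subr0.
  by rewrite mulrBr ee ef.
have: f * (1 - (e - f)) + (1 - f) \in M by rewrite rpredD.
rewrite mulrBr mulrBr ff mulr1 [f * e]mulrC ef subrr subr0.
by rewrite addrC subrK idealr1.
Qed.

(** With [e = 2 * y], the annihilator of [e] is nonzero since it contains the
    cofactor that witnesses the zero-divisor 2.  An idempotent [f] of [eR] gives
    the square root [2 * f - e] of [e]; absorbing the difference of the squares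
    of [2 * f - e] and [e] into that ideal forces [f] to be [0] or [e]. *)
Lemma sdf_primitive (R : comNzRingType) (y : R)
    (h2 : 2%:R != 0 :> R) (h2z : zero_divisor (2%:R : R))
    (hy : 2%:R ^+ 2 * y = 2%:R)
    (sdf : forall I : idealr R, nonzero_ideal I -> sdf_absorbing I) :
  primitive_idempotent (2%:R * y).
Proof.
have [ee e2] := two_idempotent hy.
have ey : 2%:R * y = y * 2%:R :> R by rewrite mulrC.
set e := 2%:R * y in ee e2 ey *.
have e0 : e != 0 by apply: contraNneq h2 => e0; rewrite -e2 e0 mul0r.
split=> // f ff ef.
have [I hI] := ann_ideal e0.
have I0 : nonzero_ideal I.
  have [z z0 z2] := h2z; exists z => //.
  by rewrite hI ey -mulrA z2 mulr0.
pose a := 2%:R * f - e.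
have aa : a ^+ 2 = e.
  have -> :
      a ^+ 2 = 4%:R * (f * f) - 4%:R * (e * f) + e * e by rewrite /a; ring.
  by rewrite ff ef ee subrr add0r.
have a0 : a != 0 by apply: contraNneq e0 => a0; rewrite -aa a0 expr2 mul0r.
(* In the factor [eR] the inverse of 2 is [y * e]. *)
have cancel g : e * g = g -> e * (2%:R * g) == 0 -> g = 0.
  by move=> eg; rewrite mulrA e2 => /eqP h; rewrite -eg ey -mulrA h mulr0.
have [||] := sdf I I0 a e a0 e0.
- by rewrite aa expr2 ee subrr idealr0.
- by rewrite hI /a subrK => /cancel->; [left|].
have -> : a - e = 2%:R * (f - e) by rewrite /a; ring.
rewrite hI => /cancel fe; right; apply/eqP; rewrite -subr_eq0; apply/eqP/fe.
by rewrite mulrBr ef ee.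
Qed.

(** Membership in [I] is tested separately on the factors [(1 - e)R] and [eR],
    where [e = 2 * y]: on the former both [a + b] and [a - b] are always
    absorbed, so only the field [eR] has to choose between them. *)
Lemma primitive_sdf (R : comNzRingType) (hR : von_neumann_regular R) (y : R)
    (hy : 2%:R ^+ 2 * y = 2%:R)
    (he : primitive_idempotent (2%:R * y)) (I : idealr R) :
  sdf_absorbing I.
Proof.
move=> a b _ _ abI; have [_ e2] := two_idempotent hy.
set e := 2%:R * y in he e2.
have {}e2 : (1 - e) * 2%:R = 0 by rewrite mulrBl mul1r e2 subrr.
(* [1 - e] kills 2, so after multiplication by it the squares of [a + b] and
   [a - b] both become [a ^+ 2 - b ^+ 2]. *)
have comp c : c = a + b \/ c = a - b -> (1 - e) * c \in I.
  move=> hc; apply: vnr_radical => //.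
  have -> : ((1 - e) * c) ^+ 2 = (1 - e) ^+ 2 * (a ^+ 2 - b ^+ 2).
    case: hc => ->.
      have -> : ((1 - e) * (a + b)) ^+ 2 = (1 - e) ^+ 2 * (a ^+ 2 - b ^+ 2)
        + (1 - e) * 2%:R * ((1 - e) * b * (a + b)) by ring.
      by rewrite e2 mul0r addr0.
    have -> : ((1 - e) * (a - b)) ^+ 2 = (1 - e) ^+ 2 * (a ^+ 2 - b ^+ 2)
      - (1 - e) * 2%:R * ((1 - e) * b * (a - b)) by ring.
    by rewrite e2 mul0r subr0.
  exact: idealMr.
have glue c : c = a + b \/ c = a - b -> e * c \in I -> c \in I.
  move=> /comp h1 h2; have -> : c = (1 - e) * c + e * c by ring.
  exact: rpredD.
have [s0|s0] := eqVneq (e * (a + b)) 0.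
  by left; apply: glue; [left|rewrite s0 idealr0].
have [z ez] := primitive_dvd hR he s0.
right; apply: glue; first by right.
have -> : e * (a - b) = z * (a ^+ 2 - b ^+ 2) by rewrite ez; ring.
exact: idealMr.
Qed.

Theorem theorem3p7 (R : comNzRingType) (hR : von_neumann_regular R)
    (h2_neq0 : 2%:R != 0 :> R) (h2_zdiv : zero_divisor (2%:R : R)) :
  [<-> (* (a) *)
       forall I : idealr R, sdf_absorbing I;
       (* (b) *)
       forall I : idealr R, nonzero_ideal I -> sdf_absorbing I;
       (* (c) *)
       exists M : idealr R,
         [/\ maximal_ideal M, residue_char_neq2 M &
             forall N : idealr R,
               maximal_ideal N -> residue_char_neq2 N -> N =i M]].
Proof.
have [y hy] := hR 2%:R.
tfae.
- by move=> sdf I _.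
- move=> sdf; apply: (primitive_unique_maximal hR hy).
  exact: sdf_primitive.
- case=> M [_ _ uniqM]; apply: (primitive_sdf hR hy).
  exact: (unique_maximal_primitive h2_neq0 hy uniqM).
Qed.
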